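(* Consider the controlled random walk and the associated model $\langle\mathbf{D},\mathcal{R},\mathcal{Q}\rangle$ described in the context. Suppose that the following two conditions hold. (1) For each average optimal decision $d^*\in\mathbf{D}^*$, the matrix $\mathcal{Q}(d^* )$ corresponds to a Markov chain without transient states. (2) Either $\gamma^J<1$ for some $J\ge1$, or, for each $d^*\in\mathbf{D}^*$, the matrix $\mathcal{Q}(d^* )$ is aperiodic. Then there is $I<\infty$ such that, for all $i\ge I$, the maximum in $$V(i)=\max_{a\in\mathbf{A}}\Big\{R^a+\sum_{m=1}^M V(i-m)p_m(a)\Big\}$$ is only provided by $a\in\mathbf{A}_*$.
   Context: Controlled random walk. $\mathbf{A}$ is a nonempty finite action set, $M\ge1$ an integer; for each $a\in\mathbf{A}$, $(p_1(a),\ldots,p_M(a))$ is a probability distribution on $\{1,\ldots,M\}$ and $R^a\in\mathbb{R}$ is a reward. On the state space $\mathbf{X}=\{-M,-M+1,\ldots\}$, states $i<0$ are absorbing with zero reward; in a state $i\ge0$, action $a$ yields reward $R^a$ and moves the state to $i-m$ with probability $p_m(a)$. The maximal total expected reward $V$ is the unique solution of $V(i)=0$ for $i=-M,\ldots,-1$ and $V(i)=\max_{a\in\mathbf{A}}\{R^a+\sum_{m=1}^M V(i-m)p_m(a)\}$ for $i\ge0$. Put $L^a:=\sum_{m=1}^M m\,p_m(a)\ge1$, $c_*:=\max_{a\in\mathbf{A}}R^a/L^a$, and let $\mathbf{A}_*$ be the set of actions attaining this maximum. Associated model. $\mathbf{S}=\{0,\ldots,M-1\}$. For $a\in\mathbf{A}$,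 $P(a)$ is the stochastic $M\times M$ matrix with $P_{s,j}(a)=p_m(a)$, where $m\in\{1,\ldots,M\}$ is determined by $m\equiv s-j \pmod M$; and $r_s(a):=L^a\left(\frac{R^a}{L^a}-c_*\right)$ for all $s\in\mathbf{S}$. $\mathbf{D}$ is the set of all mappings $d:\mathbf{S}\to\mathbf{A}$. The vector $\mathcal{R}(d)\in\mathbb{R}^M$ and the stochastic matrix $\mathcal{Q}(d)$ are given recursively by $\mathcal{R}_0(d)=r_0(d(0))$, $\mathcal{Q}_{0,j}(d)=P_{0,j}(d(0))$, and, for $l=0,\ldots,M-2$, $$\mathcal{R}_{l+1}(d)=r_{l+1}(d(l+1))+\sum_{j=0}^l P_{l+1,j}(d(l+1))\mathcal{R}_j(d),$$ $$\mathcal{Q}_{l+1,j}(d)=\sum_{i=0}^l P_{l+1,i}(d(l+1))\mathcal{Q}_{i,j}(d)+\mathbf{1}\{j\ge l+1\}P_{l+1,j}(d(l+1)).$$ $\mathcal{Q}^*(d):=\lim_{n\to\infty}\frac1n\sum_{k=0}^{n-1}\mathcal{Q}^k(d)$ (the limit exists). $\mathbf{D}^*$ is the set of average optimal decisions, i.e. of $d^*\in\mathbf{D}$ with $\mathcal{Q}^*(d)\mathcal{R}(d)\le\mathcal{Q}^*(d^* )\mathcal{R}(d^* )$ component-wise for all $d\in\mathbf{D}$. A stochastic matrix is aperiodic if the corresponding Markov chain is. For $J\ge1$ and sequences $d^1=\{d^1_1,\ldots,d^1_J\}$, $d^2=\{d^2_1,\ldots,d^2_J\}$ of decisions from $\mathbf{D}$,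 let $\mathcal{Q}^{(J,i)}:=\mathcal{Q}(d^i_1)\mathcal{Q}(d^i_2)\cdots\mathcal{Q}(d^i_J)$, $i=1,2$, $\eta(d^1,d^2):=\min_{(s,u)\in\mathbf{S}^2}\sum_{l\in\mathbf{S}}\min\{\mathcal{Q}^{(J,1)}_{s,l},\mathcal{Q}^{(J,2)}_{u,l}\}$, and $\gamma^J:=1-\min_{(d^1,d^2)}\eta(d^1,d^2)\in[0,1]$ (minimum over all pairs of such sequences). *)

(* Defs.v *)
From HB Require Import structures.
From mathcomp Require Import all_boot all_order all_algebra.
From mathcomp Require Import all_classical all_reals all_analysis.

Set Implicit Arguments.
Unset Strict Implicit.
Unset Printing Implicit Defensive.

Import Order.TTheory GRing.Theory Num.Theory.
Import numFieldNormedType.Exports.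
Local Open Scope ring_scope.

(* The value on an empty index type is a dummy; every use below is at a
   nonempty one. *)
Definition fmax (R : realType) (T : finType) (F : T -> R) : R :=
  if [pick x : T] is Some x0 then \big[Num.max/F x0]_(x : T) F x else 0.

Definition fmin (R : realType) (T : finType) (F : T -> R) : R :=
  if [pick x : T] is Some x0 then \big[Num.min/F x0]_(x : T) F x else 0.

Lemma fmax_ge (R : realType) (T : finType) (F : T -> R) x : F x <= fmax F.
Proof. by rewrite /fmax; case: pickP => [x0 _|/(_ x)//]; exact: le_bigmax. Qed.

Lemma fmax_attained (R : realType) (T : finType) (F : T -> R) (x : T) :
  exists y, fmax F = F y.
Proof.
rewrite /fmax; case: pickP => [x0 _|/(_ x)//].
elim/big_ind: _ => [|u v [y ->] [z ->]|y _]; [by exists x0| |by exists y].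
by case: (leP (F y) (F z)) => _; [exists z | exists y].
Qed.

Lemma fmin_le (R : realType) (T : finType) (F : T -> R) x : fmin F <= F x.
Proof. by rewrite /fmin; case: pickP => [x0 _|/(_ x)//]; exact: bigmin_le. Qed.

Lemma fmin_attained (R : realType) (T : finType) (F : T -> R) (x : T) :
  exists y, fmin F = F y.
Proof.
rewrite /fmin; case: pickP => [x0 _|/(_ x)//].
elim/big_ind: _ => [|u v [y ->] [z ->]|y _]; [by exists x0| |by exists y].
by case: (leP (F y) (F z)) => _; [exists y | exists z].
Qed.

(* Throughout, [p m a] is the probability p_m(a) that action [a] moves the walk
   down by [m]; only the values at 1 <= m <= M are ever used.  [rew a] is the
   reward R^a. *)

Definition bellman_rhs (R : realType) (A : finType) (M : nat)
    (p : nat -> A -> R) (rew : A -> R) (V : int -> R) (i : int) (a : A) : R :=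
  rew a + \sum_(1 <= m < M.+1) V (i - m%:Z) * p m a.

(* The state space {-M, -M+1, ...} is the part of [int] above -M; nothing is
   required of [V] below it. *)
Definition max_total_reward (R : realType) (A : finType) (M : nat)
    (p : nat -> A -> R) (rew : A -> R) (V : int -> R) : Prop :=
  (forall i : int, - M%:Z <= i -> i < 0 -> V i = 0) /\
  (forall i : int, 0 <= i -> V i = fmax (bellman_rhs M p rew V i)).

(* L^a *)
Definition mean_step (R : realType) (A : finType) (M : nat)
    (p : nat -> A -> R) (a : A) : R :=
  \sum_(1 <= m < M.+1) m%:R * p m a.

(* c_* *)
Definition best_ratio (R : realType) (A : finType) (M : nat)
    (p : nat -> A -> R) (rew : A -> R) : R :=
  fmax (fun a => rew a / mean_step M p a).

(* A_* *)
Definition best_actions (R : realType) (A : finType) (M : nat)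
    (p : nat -> A -> R) (rew : A -> R) : {set A} :=
  [set a | rew a / mean_step M p a == best_ratio M p rew].

(* The m in {1, ..., M} with m = s - j modulo M. *)
Definition step_of (M s j : nat) : nat :=
  if (j < s)%N then (s - j)%N else (M + s - j)%N.

Lemma step_ofP (M : nat) (s j : 'I_M) :
  [/\ (1 <= step_of M s j <= M)%N, step_of M s j + j = s %[mod M] &
   forall m, (1 <= m <= M)%N -> m + j = s %[mod M] -> m = step_of M s j].
Proof.
have hs := ltn_ord s; have hj := ltn_ord j.
have [b e] : (1 <= step_of M s j <= M)%N /\ step_of M s j + j = s %[mod M].
  rewrite /step_of; case: (ltnP j s) => h; split.
  - by rewrite subn_gt0 h (leq_trans (leq_subr _ _) (ltnW hs)).
  - by rewrite subnK// ltnW.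
  - rewrite subn_gt0 ltn_addr//=.
    by rewrite leq_subLR addnC leq_add2r.
  - by rewrite subnK ?modnDl// ltnW// ltn_addr.
split=> // m bm em.
have /eqP : m = step_of M s j %[mod M].
  by apply/eqP; rewrite -(eqn_modDr j); apply/eqP; rewrite em e.
move: b bm; case: m {em} => // m; case: (step_of M s j) e => // k _ /= hk hm.
rewrite -addn1 -[X in _ == X %[mod _]]addn1 eqn_modDr !modn_small//.
by move=> /eqP ->; rewrite addn1.
Qed.

Definition assoc_P (R : realType) (A : finType) (M : nat)
    (p : nat -> A -> R) (a : A) : 'M[R]_M :=
  \matrix_(s, j) p (step_of M s j) a.

Definition assoc_r (R : realType) (A : finType) (M : nat)
    (p : nat -> A -> R) (rew : A -> R) (s : 'I_M) (a : A) : R :=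
  mean_step M p a * (rew a / mean_step M p a - best_ratio M p rew).

(* The set D of decisions. *)
Notation decision A M := {ffun 'I_M -> A}.

(* The recursions for R(d) and Q(d) run over the rows l = 0, ..., M-1 and use
   all previous rows; [k] is fuel, and [k = l] suffices for row [l] (see
   [dec_rewardE] and [dec_transE] for the recursions themselves). *)
Fixpoint dec_reward_rec (R : realType) (A : finType) (M : nat)
    (p : nat -> A -> R) (rew : A -> R) (d : decision A M) (k : nat)
    (l : 'I_M) : R :=
  assoc_r p rew l (d l) +
  (if k is k'.+1 then
     \sum_(j < M | (j < l)%N)
        assoc_P M p (d l) l j * dec_reward_rec p rew d k' j
   else 0).

Fixpoint dec_trans_rec (R : realType) (A : finType) (M : nat)
    (p : nat -> A -> R) (d : decision A M) (k : nat) (l j : 'I_M) : R :=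
  (if k is k'.+1 then
     \sum_(i < M | (i < l)%N) assoc_P M p (d l) l i * dec_trans_rec p d k' i j
   else 0) +
  (if (l <= j)%N then assoc_P M p (d l) l j else 0).

Definition dec_reward (R : realType) (A : finType) (M : nat)
    (p : nat -> A -> R) (rew : A -> R) (d : decision A M) : 'cV[R]_M :=
  \col_l dec_reward_rec p rew d l l.

Definition dec_trans (R : realType) (A : finType) (M : nat)
    (p : nat -> A -> R) (d : decision A M) : 'M[R]_M :=
  \matrix_(l, j) dec_trans_rec p d l l j.

Lemma dec_rewardE (R : realType) (A : finType) (M : nat)
    (p : nat -> A -> R) (rew : A -> R) (d : decision A M) (l : 'I_M) :
  dec_reward p rew d l ord0 = assoc_r p rew l (d l) +
    \sum_(j < M | (j < l)%N) assoc_P M p (d l) l j * dec_reward p rew d j ord0.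
Proof.
have none (i : 'I_M) (F : 'I_M -> R) : (i <= 0)%N ->
    \sum_(m < M | (m < i)%N) F m = 0.
  by rewrite leqn0 => /eqP E; rewrite big_pred0// => m; rewrite E.
have fuel k k' (i : 'I_M) : (i <= k)%N -> (i <= k')%N ->
    dec_reward_rec p rew d k i = dec_reward_rec p rew d k' i.
  elim: k k' i => [|k IH] [|k'] i hk hk' //=; [by rewrite none..|].
  congr (_ + _); apply: eq_bigr => m hm; congr (_ * _).
  by apply: IH; rewrite -ltnS (leq_trans hm).
rewrite mxE (fuel _ l.+1)//=; congr (_ + _); apply: eq_bigr => j hj.
by congr (_ * _); rewrite mxE (fuel l j)// ltnW.
Qed.

Lemma dec_transE (R : realType) (A : finType) (M : nat)
    (p : nat -> A -> R) (d : decision A M) (l j : 'I_M) :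
  dec_trans p d l j =
    \sum_(i < M | (i < l)%N) assoc_P M p (d l) l i * dec_trans p d i j +
    (l <= j)%N%:R * assoc_P M p (d l) l j.
Proof.
have none (i : 'I_M) (F : 'I_M -> R) : (i <= 0)%N ->
    \sum_(m < M | (m < i)%N) F m = 0.
  by rewrite leqn0 => /eqP E; rewrite big_pred0// => m; rewrite E.
have fuel k k' (i : 'I_M) : (i <= k)%N -> (i <= k')%N ->
    dec_trans_rec p d k i j = dec_trans_rec p d k' i j.
  elim: k k' i => [|k IH] [|k'] i hk hk' //=; [by rewrite none..|].
  congr (_ + _); apply: eq_bigr => m hm; congr (_ * _).
  by apply: IH; rewrite -ltnS (leq_trans hm).
rewrite mxE (fuel _ l.+1)//= mulr_natl mulrb; congr (_ + _).
by apply: eq_bigr => i hi; congr (_ * _); rewrite mxE (fuel l i)// ltnW.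
Qed.

(* Q^* = lim_n (1/n) sum_(k < n) Q^k, taken entrywise; the term at n = 0 is
   irrelevant. *)
Definition cesaro_lim (R : realType) (M : nat) (Q : 'M[R]_M) : 'M[R]_M :=
  \matrix_(i, j) limn (fun n : nat => n%:R^-1 * \sum_(k < n) (Q ^+ k) i j).

Definition average_optimal (R : realType) (A : finType) (M : nat)
    (p : nat -> A -> R) (rew : A -> R) (dstar : decision A M) : Prop :=
  forall (d : decision A M) (s : 'I_M),
    (cesaro_lim (dec_trans p d) *m dec_reward p rew d) s ord0 <=
    (cesaro_lim (dec_trans p dstar) *m dec_reward p rew dstar) s ord0.

(* Probability that the chain started at [s] visits [t] at time n+1, and not at
   the times 1, ..., n. *)
Fixpoint first_passage (R : realType) (M : nat) (Q : 'M[R]_M) (n : nat)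
    (s t : 'I_M) : R :=
  if n is n'.+1 then \sum_(k < M | k != t) Q s k * first_passage Q n' k t
  else Q s t.

(* [s] is transient when the probability of ever returning to it is < 1. *)
Definition transient (R : realType) (M : nat) (Q : 'M[R]_M) (s : 'I_M) : Prop :=
  (\sum_(0 <= n <oo) (first_passage Q n s s)%:E < 1)%E.

(* [g] is the gcd of the possible return times {n >= 1 | Q^n(s, s) > 0}
   (0 if there is none). *)
Definition has_period (R : realType) (M : nat) (Q : 'M[R]_M) (s : 'I_M)
    (g : nat) : Prop :=
  let return_time n := (0 < n)%N /\ 0 < (Q ^+ n) s s in
  (forall n : nat, return_time n -> (g %| n)%N) /\
  (forall e : nat, (forall n : nat, return_time n -> (e %| n)%N) ->
     (e %| g)%N).

Definition aperiodic (R : realType) (M : nat) (Q : 'M[R]_M) : Prop :=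
  forall s : 'I_M, has_period Q s 1.

(* A sequence of decisions is a J-tuple; the factors of Q^(J,i) are taken in
   the order of the sequence. *)
Definition trans_prod (R : realType) (A : finType) (M : nat)
    (p : nat -> A -> R) (J : nat) (ds : J.-tuple (decision A M)) : 'M[R]_M :=
  \prod_(d <- ds) dec_trans p d.

Definition overlap (R : realType) (A : finType) (M : nat)
    (p : nat -> A -> R) (J : nat) (d1 d2 : J.-tuple (decision A M)) : R :=
  fmin (fun su : 'I_M * 'I_M =>
    \sum_(l < M) Num.min (trans_prod p d1 su.1 l) (trans_prod p d2 su.2 l)).

Definition gamma (R : realType) (A : finType) (M : nat)
    (p : nat -> A -> R) (J : nat) : R :=
  1 - fmin (fun dd : J.-tuple (decision A M) * J.-tuple (decision A M) =>
    overlap p dd.1 dd.2).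

(* Main.v *)
Require Import Defs.
From HB Require Import structures.
From mathcomp Require Import all_boot all_order all_algebra.
From mathcomp Require Import all_classical all_reals all_analysis.
From mathcomp Require Import zify ring lra.

Set Implicit Arguments.
Unset Strict Implicit.
Unset Printing Implicit Defensive.

Import Order.TTheory GRing.Theory Num.Theory.
Import numFieldNormedType.Exports.
Local Open Scope classical_set_scope.
Local Open Scope ring_scope.

(** Write W(i) = V(i) - c_* i and cut W into blocks w_n of length M.  Then
    w_{n+1} = max_d (R(d) + Q(d) w_n), where R(d) <= 0, with R(d) = 0 exactly
    when d takes all its values in A_*; such d are average optimal, and the
    sequence w_n is bounded.

    Fix d constant with value in A_* and put Q = Q(d).  By (1), Q has an
    everywhere positive invariant vector v.  As w_{n+1} >= Q w_n, the quantity
    2 B v.w_n - v.w_n^2 increases and is bounded, and its increments control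
    w_n(j) - w_{n+1}(s) along every edge Q(s,j) > 0; hence these differences
    tend to 0.  Along closed paths this gives w_{n+k}(s) - w_n(s) -> 0 for each
    return time k, hence for k = 1 under aperiodicity; if instead any two states
    have a common J-step successor, the oscillation of w_n tends to 0.  In both
    cases w_{n+1} - w_n -> 0.

    If now d is maximizing in infinitely many blocks, then R(d) + Q(d) u = u has
    bounded approximate solutions u to any precision, so the Cesaro means of
    Q(d)^k R(d) tend to 0 and d is average optimal.  By (1), Q(d) has a positive
    invariant vector, which must annihilate R(d) <= 0; thus R(d) = 0 and d takes
    its values in A_*.  Since there are finitely many d, the theorem follows. *)

(** * Stochastic matrices, recurrence and invariant vectors *)

Definition stochastic (R : realType) (M : nat) (Q : 'M[R]_M) : Prop :=
  (forall s j, 0 <= Q s j) /\ (forall s, \sum_j Q s j = 1).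

Definition reaches (R : realType) (M : nat) (Q : 'M[R]_M) : rel 'I_M :=
  connect (fun s j => 0 < Q s j).

Lemma stochastic_le1 (R : realType) (M : nat) (Q : 'M[R]_M) s j :
  stochastic Q -> Q s j <= 1.
Proof.
by case=> Q0 Q1; rewrite -(Q1 s) (bigD1 j)//= lerDl sumr_ge0.
Qed.

Lemma stochasticX (R : realType) (M : nat) (Q : 'M[R]_M) k :
  stochastic Q -> stochastic (Q ^+ k).
Proof.
case=> Q0 Q1; elim: k => [|k [IH0 IH1]]; rewrite ?expr0 ?exprS.
  have E s j : (1 : 'M[R]_M) s j = (s == j)%:R.
    by rewrite -[1 : 'M[R]_M]/(1%:M) mxE.
  split=> [s j|s]; first by rewrite E.
  rewrite (bigD1 s)//= E eqxx big1 ?addr0// => j /negPf js.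
  by rewrite E eq_sym js.
rewrite -mulmxE; split=> [s j|s].
  by rewrite mxE sumr_ge0// => i _; rewrite mulr_ge0.
under eq_bigr do rewrite mxE.
rewrite exchange_big/= -[RHS](Q1 s); apply: eq_bigr => i _.
by rewrite -mulr_sumr IH1 mulr1.
Qed.

(* The rows outside a closed set are redirected into it, so that a left
   eigenvector of the modified matrix is supported in that set. *)
Lemma closed_set_invariant (R : realType) (M : nat) (Q : 'M[R]_M)
    (C : {pred 'I_M}) (c : 'I_M) :
  stochastic Q -> c \in C ->
  (forall s j, s \in C -> 0 < Q s j -> j \in C) ->
  exists v : 'I_M -> R, [/\ forall s, 0 <= v s, forall s, s \notin C -> v s = 0,
    exists s, 0 < v s & forall j, \sum_s v s * Q s j = v j].
Proof.
move=> [Q0 Q1] cC closedC.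
pose T : 'M[R]_M := \matrix_(s, j) if s \in C then Q s j else (j == c)%:R.
have T0 s j : 0 <= T s j by rewrite mxE; case: ifP => // _; rewrite ler0n.
have T1 s : \sum_j T s j = 1.
  under eq_bigr do rewrite mxE.
  case: (s \in C) => //; rewrite (bigD1 c)//= eqxx big1 ?addr0// => j /negPf -> //.
(* [T - 1%:M] is singular because it kills the constant vector, so it also has a nonzero left kernel
   vector. *)
have : kermx (T - 1%:M) != 0.
  rewrite kermx_eq0 row_free_unit; apply/negP => Tu.
  have : (T - 1%:M) *m const_mx 1 = 0 :> 'cV_M.
    apply/colP => s; rewrite mulmxBl mul1mx !mxE.
    by under eq_bigr do rewrite [const_mx _ _ _]mxE mulr1; rewrite T1 subrr.
  move=> /(congr1 (mulmx (invmx (T - 1%:M)))); rewrite mulKmx// mulmx0.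
  by move=> /colP /(_ c) /eqP; rewrite !mxE oner_eq0.
case/rowV0Pn => v /sub_kermxP; rewrite mulmxBr mulmx1 => /eqP.
rewrite subr_eq0 => /eqP vT vn0.
have vTj j : v 0 j = \sum_s v 0 s * T s j by rewrite -[in LHS]vT mxE.
have le_abs j : `|v 0 j| <= \sum_s `|v 0 s| * T s j.
  rewrite vTj (le_trans (ler_norm_sum _ _ _))// ler_sum// => s _.
  by rewrite normrM (ger0_norm (T0 _ _)).
(* Absolute values keep invariance: [le_abs] bounds each entry of [|v|] by that of [|v| T], and both
   vectors have the same total since the rows of [T] sum to 1. *)
have eq_abs j : \sum_s `|v 0 s| * T s j = `|v 0 j|.
  apply/eqP; rewrite -subr_eq0; apply/eqP.
  apply: (@psumr_eq0P _ _ xpredT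
    (fun j => \sum_s `|v 0 s| * T s j - `|v 0 j|)) => //.
    by move=> i _; rewrite subr_ge0.
  rewrite sumrB exchange_big/= -sumrB big1// => s _.
  by rewrite -mulr_sumr T1 mulr1 subrr.
have out s : s \notin C -> `|v 0 s| = 0.
  move=> sC; rewrite -eq_abs big1// => i _; rewrite mxE; case: ifP => iC.
    have [|Qle0] := ltP 0 (Q i s); first by move/(closedC _ _ iC); rewrite (negPf sC).
    have -> : Q i s = 0 by apply/eqP; rewrite eq_le Qle0 Q0.
    by rewrite mulr0.
  by case: eqP => [sc|_]; [rewrite sc cC in sC | rewrite mulr0].
exists (fun s => `|v 0 s|); split=> //.
  have [j vj] : exists j, v 0 j != 0.
    apply/existsP; apply: contra_neqT vn0; rewrite negb_exists => /forallP v0.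
    by apply/rowP => j; rewrite mxE; have := v0 j; rewrite negbK => /eqP.
  by exists j; rewrite normr_gt0.
move=> j; rewrite -eq_abs; apply: eq_bigr => s _; rewrite mxE; case: ifP => // sC.
by rewrite out ?sC// !mul0r.
Qed.

Lemma first_passage_ge0 (R : realType) (M : nat) (Q : 'M[R]_M) n s t :
  stochastic Q -> 0 <= first_passage Q n s t.
Proof.
case=> Q0 _; elim: n s => //= n IH s.
by apply: sumr_ge0 => k _; rewrite mulr_ge0.
Qed.

Lemma first_passage_reaches (R : realType) (M : nat) (Q : 'M[R]_M) n s t :
  stochastic Q -> 0 < first_passage Q n s t -> reaches Q s t.
Proof.
move=> sQ; elim: n s => [|n IH] s /=; first exact: connect1.
case: (boolP (reaches Q s t)) => // nst; rewrite big1 ?ltxx// => k _.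
apply/eqP; rewrite mulf_eq0; apply/orP.
have [Qk|Qk] := ltP 0 (Q s k); last by left; rewrite eq_le Qk sQ.1.
right; rewrite eq_le first_passage_ge0// andbT leNgt; apply: contra nst => /IH.
exact/connect_trans/connect1.
Qed.

Lemma sum_first_passageS (R : realType) (M : nat) (Q : 'M[R]_M) N s t :
  \sum_(n < N.+1) first_passage Q n s t =
  Q s t + \sum_(k < M | k != t) Q s k * \sum_(n < N) first_passage Q n k t.
Proof.
rewrite big_ord_recl/=; congr (_ + _); rewrite exchange_big/=.
by apply: eq_bigr => k _; rewrite mulr_sumr.
Qed.

Lemma sum_first_passage_le1 (R : realType) (M : nat) (Q : 'M[R]_M) N s t :
  stochastic Q -> \sum_(n < N) first_passage Q n s t <= 1.
Proof.
move=> [Q0 Q1]; elim: N s => [|N IH] s; first by rewrite big_ord0.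
rewrite sum_first_passageS -(Q1 s) [leRHS](bigD1 t)//= lerD2l.
by apply: ler_sum => k _; rewrite ler_piMr.
Qed.

(* The probability of ever hitting [t] is harmonic off [t], at most 1, and
   equal to 1 at the recurrent state [t]; so it stays equal to 1 along every
   path from [t]. *)
Lemma recurrent_reaches_sym (R : realType) (M : nat) (Q : 'M[R]_M) t j :
  stochastic Q -> ~ transient Q t -> reaches Q t j -> reaches Q j t.
Proof.
move=> sQ rt; have [Q0 Q1] := sQ.
pose F N i := \sum_(n < N) first_passage Q n i t.
have F1 N i : F N i <= 1 by exact: sum_first_passage_le1.
(* [hit i] expresses that the chain started at [i] visits [t] with probability 1, as a supremum over
   finite horizons. *)
pose hit i := forall e, 0 < e -> exists N, 1 - e < F N i.
have hit_t : hit t.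
  move=> e e0; apply: contrapT => nN; apply: rt.
  have leF N : F N t <= 1 - e.
    by rewrite leNgt; apply/negP => h; apply: nN; exists N.
  apply: (@le_lt_trans _ _ (1 - e)%:E); last by rewrite lte_fin ltrBlDr ltrDl.
  apply: lime_le.
    by apply: is_cvg_nneseries => n _ _; rewrite lee_fin first_passage_ge0.
  by apply: nearW => N; rewrite sumEFin lee_fin big_mkord leF.
have hit_step i k : hit i -> 0 < Q i k -> hit k.
  move=> hi Qk; have [->//|kt] := eqVneq k t.
  (* A deficit of [e] in the hitting probability at [k] costs at least [Q i k * e] at [i], whence
     this margin. *)
  move=> e e0; have [[|N]] := hi (Q i k * e) (mulr_gt0 Qk e0).
    rewrite /F big_ord0 => h; exists 0; rewrite /F big_ord0.
    have : Q i k * e <= 1 * e by rewrite ler_pM2r// stochastic_le1.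
    lra.
  rewrite /F sum_first_passageS -/(F _ _) => h; exists N.
  have : Q i t + \sum_(k < M | k != t) Q i k * F N k <= 1 - Q i k * (1 - F N k).
    rewrite -[X in _ <= X - _](Q1 i) [X in _ <= X - _](bigD1 t)//= -addrA lerD2l.
    rewrite (bigD1 k)//= [in leRHS](bigD1 k)//=.
    have : \sum_(i0 < M | (i0 != t) && (i0 != k)) Q i i0 * F N i0 <=
           \sum_(i0 < M | (i0 != t) && (i0 != k)) Q i i0.
      by apply: ler_sum => l _; rewrite ler_piMr.
    lra.
  move=> h'; have : Q i k * (1 - F N k) < Q i k * e by rewrite /F in h' *; lra.
  by rewrite ltr_pM2l//; rewrite /F; lra.
move=> /connectP[q + ->].
have hit_path i l : hit i -> path (fun s j => 0 < Q s j) i l -> hit (last i l).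
  elim: l i => //= k l IH i hi /andP[Qk]; apply: IH.
  exact: hit_step hi Qk.
move=> /(hit_path _ _ hit_t) /(_ 1 ltr01)[N]; rewrite subrr => FN.
have [| |n] := @psumr_neq0P _ _ xpredT (fun n : 'I_N => first_passage Q n (last t q) t).
- by move=> n _; exact: first_passage_ge0.
- by rewrite -/(F N _) => FN0; rewrite FN0 ltxx in FN.
- exact: first_passage_reaches.
Qed.

(** The states reachable from [t] form a closed set, which supports an invariant vector. Each of
    them leads back to [t] by recurrence, and invariance carries positivity along the path to [t].
    Summing over all [t] gives positivity everywhere. *)
Lemma recurrent_positive_invariant (R : realType) (M : nat) (Q : 'M[R]_M) :
  stochastic Q -> (forall s, ~ transient Q s) ->
  exists v : 'I_M -> R,
    (forall s, 0 < v s) /\ (forall j, \sum_s v s * Q s j = v j).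
Proof.
move=> sQ rQ.
have /choice[v vP] t : exists v : 'I_M -> R, [/\ forall s, 0 <= v s, 0 < v t &
    forall j, \sum_s v s * Q s j = v j].
  have [||v [v0 vC [s vs] vQ]] :=
      @closed_set_invariant _ _ Q (reaches Q t) t sQ.
  - exact: connect0.
  - by move=> s j ts Qs; apply: connect_trans ts (connect1 _).
  exists v; split=> //.
  have : reaches Q t s by apply: contraTT vs => /vC ->; rewrite ltxx.
  move/(recurrent_reaches_sym sQ (rQ t)) => /connectP[q + ->].
  elim: q s vs => //= k q IH s vs /andP[Qk]; apply: IH.
  rewrite -vQ (bigD1 s)//= ltr_pwDl ?mulr_gt0// sumr_ge0// => i _.
  by rewrite mulr_ge0// sQ.1.
exists (fun s => \sum_t v t s); split=> [s|j].
  have [v0 vs _] := vP s.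
  rewrite (bigD1 s)//= ltr_pwDl// sumr_ge0// => t _.
  by have [v0t _ _] := vP t.
under eq_bigr do rewrite mulr_suml.
rewrite exchange_big/=; apply: eq_bigr => t _.
by have [_ _ ->] := vP t.
Qed.

(** * Limits of bounded sequences with [w n.+1 >= Q w n] *)

Lemma cvgn0D (R : realType) (f g h : nat -> R) :
  f @ \oo --> (0 : R) -> g @ \oo --> (0 : R) -> (forall n, h n = f n + g n) ->
  h @ \oo --> (0 : R).
Proof. by move=> f0 g0 /funext ->; rewrite -[X in _ --> X]addr0; exact: cvgD. Qed.

Lemma cvgn0B (R : realType) (f g h : nat -> R) :
  f @ \oo --> (0 : R) -> g @ \oo --> (0 : R) -> (forall n, h n = f n - g n) ->
  h @ \oo --> (0 : R).
Proof. by move=> f0 g0 /funext ->; rewrite -[X in _ --> X]subr0; exact: cvgB. Qed.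

Lemma cvg_shift_sub (R : realType) (f : nat -> R) :
  cvgn f -> (fun n => f n.+1 - f n) @ \oo --> (0 : R).
Proof.
move=> cf; rewrite -(subrr (lim (f @ \oo))); apply: cvgB => //.
by rewrite -(cvg_shiftS f) in cf *.
Qed.

Lemma cvg_sqr_eq0 (R : realType) (f : nat -> R) :
  (fun n => f n ^+ 2) @ \oo --> (0 : R) -> f @ \oo --> (0 : R).
Proof.
move=> f2; apply/cvgr0Pnorm_lt => e e0.
have /cvgr0Pnorm_lt/(_ (e ^+ 2)) := f2; rewrite exprn_gt0// => /(_ isT).
apply: filterS => n; rewrite normrX ltr_pXn2r//.
by rewrite nnegrE ltW.
Qed.

Section Submartingale.
Variables (R : realType) (M : nat) (Q : 'M[R]_M) (v : 'I_M -> R) (B : R).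
Variable w : nat -> 'I_M -> R.
Hypothesis sQ : stochastic Q.
Hypothesis v_gt0 : forall s, 0 < v s.
Hypothesis vQ : forall j, \sum_s v s * Q s j = v j.
Hypothesis w_bound : forall n s, `|w n s| <= B.
Hypothesis w_sub : forall n s, \sum_j Q s j * w n j <= w n.+1 s.

Let sum_vQ (f : 'I_M -> R) : \sum_s v s * \sum_j Q s j * f j = \sum_j v j * f j.
Proof.
under eq_bigr do rewrite mulr_sumr.
rewrite exchange_big/=; apply: eq_bigr => j _.
by rewrite -[in RHS]vQ mulr_suml; apply: eq_bigr => s _; rewrite mulrA.
Qed.

(* [sum_s v s (2 B w n s - w n s ^+ 2)] increases with [n] by at least
   [sum_s v s sum_j Q s j (w n j - w n.+1 s) ^+ 2]. *)
Lemma submartingale_edge s j : 0 < Q s j ->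
  (fun n => w n j - w n.+1 s) @ \oo --> (0 : R).
Proof.
move=> Qsj.
pose G n := \sum_s v s * (2 * B * w n s - w n s ^+ 2).
have wB n i : - B <= w n i <= B by rewrite -ler_norml.
have sq_sum n i : \sum_k Q i k * (w n k - w n.+1 i) ^+ 2 =
    \sum_k Q i k * w n k ^+ 2 - 2 * w n.+1 i * (\sum_k Q i k * w n k) +
    w n.+1 i ^+ 2.
  have -> : w n.+1 i ^+ 2 = \sum_k Q i k * w n.+1 i ^+ 2.
    by rewrite -mulr_suml sQ.2 mul1r.
  by rewrite mulr_sumr -sumrB -big_split/=; apply: eq_bigr => k _; ring.
have incr n : v s * (Q s j * (w n j - w n.+1 s) ^+ 2) <= G n.+1 - G n.
  have -> : G n.+1 - G n = \sum_i v i * (2 * B * (w n.+1 i - \sum_k Q i k * w n k)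
      - (w n.+1 i ^+ 2 - \sum_k Q i k * w n k ^+ 2)).
    have GE m : G m = 2 * B * (\sum_i v i * w m i) - \sum_i v i * w m i ^+ 2.
      by rewrite mulr_sumr -sumrB; apply: eq_bigr => i _; ring.
    rewrite !GE -(sum_vQ (w n)) -(sum_vQ (fun i => w n i ^+ 2)).
    transitivity (2 * B * (\sum_i (v i * w n.+1 i - v i * \sum_k Q i k * w n k)) -
        \sum_i (v i * w n.+1 i ^+ 2 - v i * \sum_k Q i k * w n k ^+ 2)).
      by rewrite !sumrB; ring.
    by rewrite mulr_sumr -sumrB; apply: eq_bigr => i _; ring.
  have step i : \sum_k Q i k * (w n k - w n.+1 i) ^+ 2 <=
      2 * B * (w n.+1 i - \sum_k Q i k * w n k)
      - (w n.+1 i ^+ 2 - \sum_k Q i k * w n k ^+ 2).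
    rewrite sq_sum; have /andP[_ wiB] := wB n.+1 i; have := w_sub n i.
    set q := \sum_k Q i k * w n k => qw.
    (* Twice this product is the gap between the two sides of [step]; its factors are nonnegative by
       the bound [B] and by [w_sub]. *)
    have : 0 <= (B - w n.+1 i) * (w n.+1 i - q) by rewrite mulr_ge0// subr_ge0.
    lra.
  have sq0 i : 0 <= \sum_k Q i k * (w n k - w n.+1 i) ^+ 2.
    by rewrite sumr_ge0// => k _; rewrite mulr_ge0 ?sQ.1 ?sqr_ge0.
  rewrite [leRHS](bigD1 s)//= -[leLHS]addr0 lerD//; last first.
    rewrite sumr_ge0// => i _; apply: mulr_ge0; first exact/ltW.
    exact: le_trans (sq0 i) (step i).
  rewrite ler_pM2l// (le_trans _ (step s))// [leRHS](bigD1 j)//= lerDl.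
  by rewrite sumr_ge0// => k _; rewrite mulr_ge0 ?sQ.1 ?sqr_ge0.
have c0 : 0 < v s * Q s j by rewrite mulr_gt0.
have cG : cvgn G.
  apply: nondecreasing_is_cvgn.
    apply/nondecreasing_seqP => n; rewrite -subr_ge0 (le_trans _ (incr n))//.
    by rewrite mulrA mulr_ge0 ?sqr_ge0// ltW.
  exists (\sum_i v i * (B ^+ 2)) => _ [n _ <-]; apply: ler_sum => i _.
  rewrite ler_pM2l//; have := sqr_ge0 (B - w n i); lra.
(* The square lies between 0 and the increments of the convergent [G] divided by [v s * Q s j]. *)
apply: cvg_sqr_eq0.
have := cvgM (cvg_shift_sub cG) (cvg_cst (v s * Q s j)^-1); rewrite mul0r => cD.
apply: squeeze_cvgr; [|exact: (cvg_cst 0)|exact: cD]; apply: nearW => n.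
by rewrite sqr_ge0/= ler_pdivlMr// mulrC -mulrA.
Qed.

(** The limits along the edges of a path of length [k] telescope; each edge advances the time index
    by one. *)
Lemma submartingale_path k s j : 0 < (Q ^+ k) s j ->
  (fun n => w n j - w (n + k)%N s) @ \oo --> (0 : R).
Proof.
elim: k s => [|k IH] s.
  rewrite expr0 -[1 : 'M[R]_M]/(1%:M) mxE; case: eqP => [-> _|_]; last by rewrite ltxx.
  under eq_fun do rewrite addn0 subrr.
  exact: cvg_cst.
rewrite exprS -mulmxE mxE => Qk.
have [||i] := @psumr_neq0P _ _ xpredT (fun i => Q s i * (Q ^+ k) i j).
- by move=> i _; rewrite mulr_ge0 ?sQ.1 ?(stochasticX k sQ).1.
- by apply/eqP; rewrite gt_eqF.
have Qki := (stochasticX k sQ).1 i j.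
move=> /= QQ; have Qsi : 0 < Q s i.
  by rewrite lt0r sQ.1 andbT; apply: contraTneq QQ => ->; rewrite mul0r ltxx.
move: QQ; rewrite pmulr_rgt0// => /IH IHi.
have := submartingale_edge Qsi; rewrite -(cvg_shiftn k) => edge.
by apply: (cvgn0D IHi edge) => n /=; rewrite -addnS addrA subrK.
Qed.

(** If [l] is a common [k]-step successor of [s] and [u], then [w (n + k) s] and [w (n + k) u] both
    approach [w n l], so the oscillation of [w n] vanishes. One edge out of [s] then links times [n]
    and [n.+1]. *)
Lemma scrambling_increment0 k :
  (forall s u, exists l, 0 < (Q ^+ k) s l /\ 0 < (Q ^+ k) u l) ->
  forall s, (fun n => w n.+1 s - w n s) @ \oo --> (0 : R).
Proof.
move=> scr s.
have flat u t : (fun n => w n u - w n t) @ \oo --> (0 : R).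
  have [l [Qu Qt]] := scr u t.
  rewrite -(cvg_shiftn k).
  apply: (cvgn0B (submartingale_path Qt) (submartingale_path Qu)) => n /=; lra.
have [j _ Qsj] : exists2 j, true & 0 < Q s j.
  have [||j /= Qj] := @psumr_neq0P _ _ xpredT (Q s); last by exists j.
    by move=> i _; exact: sQ.1.
  by rewrite sQ.2; apply/eqP/oner_neq0.
apply: (cvgn0B (flat j s) (submartingale_edge Qsj)) => n; lra.
Qed.

(** The shifts [k] for which [w (n + k) s - w n s] tends to 0 contain the return times and are
    stable under addition and subtraction. By division with remainder the least positive one divides
    every return time, so it is 1. *)
Lemma aperiodic_increment0 : aperiodic Q ->
  forall s, (fun n => w n.+1 s - w n s) @ \oo --> (0 : R).
Proof.
move=> apQ s; have [_ minQ] := apQ s.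
pose per k := (fun n => w (n + k)%N s - w n s) @ \oo --> (0 : R).
have per_return k : 0 < (Q ^+ k) s s -> per k.
  move=> /submartingale_path ret.
  by apply: (cvgn0B (cvg_cst (0 : R)) ret) => n; rewrite sub0r opprB.
have per_sub a b : per (a + b)%N -> per a -> per b.
  move=> pab pa; rewrite /per -(cvg_shiftn a).
  by apply: (cvgn0B pab pa) => n /=; rewrite [(a + b)%N]addnC addnA addnAC; lra.
have per_add a b : per a -> per b -> per (a + b)%N.
  rewrite {2}/per -(cvg_shiftn a) => pa pb.
  by apply: (cvgn0D pa pb) => n /=; rewrite addnA; lra.
have [[k [k0 Qk]]|none] := pselect (exists k, (0 < k)%N /\ 0 < (Q ^+ k) s s);
  last first.
  (* Without return times every number, in particular 0, would vacuously be a common divisor of them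
     and hence divide the period 1. *)
  have : (0 %| 1)%N by apply: minQ => n rn; case: none; exists n.
  by [].
have : exists e, (0 < e)%N && `[< per e >].
  by exists k; rewrite k0; apply/asboolP/per_return.
move/ex_minnP => [e /andP[e0 /asboolP pe] mine].
have per_mul q : per (q * e)%N.
  elim: q => [|q IH]; last by rewrite mulSn; exact: per_add.
  rewrite /per mul0n; under eq_fun do rewrite addn0 subrr.
  exact: cvg_cst.
have : (e %| 1)%N.
  apply: minQ => n [_ /per_return pn]; rewrite /dvdn.
  rewrite (divn_eq n e) in pn; have {}pn := per_sub _ _ pn (per_mul _).
  have [//|r0] := posnP (n %% e)%N.
  have := mine (n %% e)%N; rewrite r0 => /(_ (introT (asboolP _) pn)).
  by rewrite leqNgt ltn_mod e0.
rewrite dvdn1 => /eqP e1; move: pe; rewrite e1 /per.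
by under eq_fun do rewrite addn1.
Qed.

End Submartingale.

(** * Cesaro means and approximate fixed points *)

Lemma cesaro_lim_ge0 (R : realType) (M : nat) (Q : 'M[R]_M) i j :
  stochastic Q -> 0 <= cesaro_lim Q i j.
Proof.
move=> sQ; rewrite mxE; set f := fun n : nat => _.
(* For a divergent sequence [limn] takes its default value 0, which satisfies the bound as well. *)
have [cf|/dvgP ->//] := pselect (cvgn f).
apply: limr_ge => //; apply: nearW => n.
rewrite mulr_ge0 ?invr_ge0// sumr_ge0// => k _.
exact: (stochasticX k sQ).1.
Qed.

(** The lower bound on the total reward allows at most [- (c / r j 0)] expected visits to a state
    [j] with [r j 0 < 0], so such a state has Cesaro weight 0. The other states have reward 0. *)
Lemma cesaro_lim_mul0 (R : realType) (M : nat) (Q : 'M[R]_M) (r : 'cV[R]_M) c s :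
  stochastic Q -> (forall j, r j 0 <= 0) ->
  (forall K, - c <= \sum_(k < K) \sum_j (Q ^+ k) s j * r j 0) ->
  (cesaro_lim Q *m r) s 0 = 0.
Proof.
move=> sQ r0 lb; rewrite mxE big1// => j _.
have := r0 j; rewrite le_eqVlt => /predU1P[->|rj]; first by rewrite mulr0.
rewrite mxE; suff f0 : (fun n : nat => n%:R^-1 * \sum_(k < n) (Q ^+ k) s j) @ \oo
    --> (0 : R) by rewrite (cvg_lim _ f0)// mul0r.
have sum_ge0 n : 0 <= \sum_(k < n) (Q ^+ k) s j.
  by rewrite sumr_ge0// => k _; exact: (stochasticX k sQ).1.
have ub n : \sum_(k < n) (Q ^+ k) s j <= - (c / r j 0).
  rewrite -mulrN -invrN ler_pdivlMr ?oppr_gt0// mulrN -[c]opprK lerN2.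
  apply: le_trans (lb n) _; rewrite mulr_suml; apply: ler_sum => k _.
  rewrite (bigD1 j)//= gerDl sumr_le0// => i _.
  by rewrite mulr_ge0_le0// (stochasticX k sQ).1.
apply: squeeze_cvgr; [|exact: (cvg_cst 0)|]; last first.
  rewrite -[X in _ --> X](mul0r (- (c / r j 0))).
  apply: (@cvgM _ _ _ _ (fun n : nat => n%:R^-1)); last exact: cvg_cst.
  by rewrite -cvg_shiftS; exact: cvg_harmonic.
apply: nearW => n; rewrite mulr_ge0 ?invr_ge0 ?sum_ge0//=.
by rewrite ler_wpM2l ?invr_ge0 ?ub.
Qed.

(** Iterating the inequality for [u] gives [u - Q ^+ K u], up to [K] error terms, as a lower bound
    for the sum; both [u] and [Q ^+ K u] are bounded by [B]. *)
Lemma approx_fixpoint_sum_ge (R : realType) (M : nat) (Q : 'M[R]_M)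
    (r : 'cV[R]_M) (B : R) :
  stochastic Q ->
  (forall e, 0 < e -> exists u : 'I_M -> R, (forall s, `|u s| <= B) /\
     (forall s, u s - e <= r s 0 + \sum_j Q s j * u j)) ->
  forall K s, - (2 * B) <= \sum_(k < K) \sum_j (Q ^+ k) s j * r j 0.
Proof.
move=> sQ fixQ K s; apply/ler_addgt0Pl => e e0.
(* With this precision the [K] accumulated errors add up to at most [e], also for [K = 0]. *)
have [|u [uB uQ]] := fixQ (e / K.+1%:R); first by rewrite divr_gt0.
set e' := e / _ in uQ.
have sumX n (f : 'I_M -> R) i : \sum_j (Q ^+ n) i j * (\sum_l Q j l * f l) =
    \sum_j (Q ^+ n.+1) i j * f j.
  under eq_bigr do rewrite mulr_sumr.
  rewrite exchange_big/= exprSr -mulmxE; apply: eq_bigr => j _.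
  by rewrite mxE mulr_suml; apply: eq_bigr => l _; rewrite mulrA.
have main n : u s - \sum_j (Q ^+ n) s j * u j - n%:R * e' <=
    \sum_(k < n) \sum_j (Q ^+ k) s j * r j 0.
  elim: n => [|n IH].
    rewrite big_ord0 mul0r subr0 expr0 (bigD1 s)//= big1 => [|j /negPf js].
      by rewrite -[1 : 'M[R]_M]/(1%:M) mxE eqxx mul1r addr0 subrr.
    by rewrite -[1 : 'M[R]_M]/(1%:M) mxE eq_sym js mul0r.
  rewrite big_ord_recr/=.
  have : 0 <= \sum_j (Q ^+ n) s j * (r j 0 + \sum_l Q j l * u l - (u j - e')).
    rewrite sumr_ge0// => j _; rewrite mulr_ge0 ?subr_ge0//.
    exact: (stochasticX n sQ).1.
  have -> : \sum_j (Q ^+ n) s j * (r j 0 + \sum_l Q j l * u l - (u j - e')) =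
      \sum_j (Q ^+ n) s j * r j 0 + \sum_j (Q ^+ n.+1) s j * u j -
      \sum_j (Q ^+ n) s j * u j + \sum_j (Q ^+ n) s j * e'.
    rewrite -sumX -!big_split/= -sumrB -big_split/=.
    by apply: eq_bigr => j _; ring.
  rewrite -mulr_suml (stochasticX n sQ).2 mul1r -(natr1 n); lra.
have QuB : \sum_j (Q ^+ K) s j * u j <= B.
  rewrite -[B]mul1r -((stochasticX K sQ).2 s) mulr_suml; apply: ler_sum => j _.
  rewrite ler_wpM2l ?(stochasticX K sQ).1//.
  by have := uB j; rewrite ler_norml => /andP[].
have := uB s; rewrite ler_norml => /andP[uBs _].
have Ke : K%:R * e' <= e.
  by rewrite /e' mulrCA -[leRHS]mulr1 ler_pM2l// ler_pdivrMr// mul1r ler_nat.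
have := main K; lra.
Qed.

(** * Decisions as affine maps on blocks of [M] values *)

Section Model.
Variables (R : realType) (A : finType) (M : nat) (p : nat -> A -> R).
Variable rew : A -> R.
Hypothesis A_gt0 : (0 < #|A|)%N.
Hypothesis M_gt0 : (1 <= M)%N.
Hypothesis p_ge0 : forall (a : A) (m : nat), (1 <= m <= M)%N -> 0 <= p m a.
Hypothesis p_sum1 : forall a : A, \sum_(1 <= m < M.+1) p m a = 1.

Let best := best_actions M p rew.

(** For fixed [l], [step_of M l] is a bijection from the states onto the step sizes 1, ..., [M]. *)
Lemma sum_step_of (F : nat -> R) (l : 'I_M) :
  \sum_(1 <= m < M.+1) F m = \sum_(j < M) F (step_of M l j).
Proof.
have stepM (j : 'I_M) : ((step_of M l j).-1 < M)%N.
  have [/andP[? ?] _ _] := step_ofP l j; lia.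
rewrite big_add1/= big_mkord.
rewrite (reindex_inj (h := fun j => Ordinal (stepM j)))/=.
  apply: eq_bigr => j _; rewrite prednK//.
  by have [/andP[]] := step_ofP l j.
move=> i j /(congr1 val)/=; rewrite /step_of => E; apply: val_inj => /=.
have := ltn_ord i; have := ltn_ord j; have := ltn_ord l.
by move: E; case: (ltnP i l) => ?; case: (ltnP j l) => ?; lia.
Qed.

Lemma assoc_P_ge0 a (l j : 'I_M) : 0 <= assoc_P M p a l j.
Proof. by rewrite mxE; apply: p_ge0; have [] := step_ofP l j. Qed.

Lemma assoc_P_sum1 a (l : 'I_M) : \sum_j assoc_P M p a l j = 1.
Proof.
by rewrite -(p_sum1 a) (sum_step_of _ l); apply: eq_bigr => j _; rewrite mxE.
Qed.

Lemma mean_step_gt0 a : 0 < mean_step M p a.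
Proof.
rewrite (lt_le_trans ltr01)// -(p_sum1 a) /mean_step !big_nat.
apply: ler_sum => m /andP[m1 mM]; rewrite ler_peMl ?ler1n//.
by apply: p_ge0; rewrite m1.
Qed.

Lemma assoc_rE (s : 'I_M) a :
  assoc_r p rew s a = rew a - best_ratio M p rew * mean_step M p a.
Proof.
rewrite /assoc_r mulrBr mulrCA mulfV ?gt_eqF ?mean_step_gt0// mulr1.
by rewrite [_ * best_ratio _ _ _]mulrC.
Qed.

Lemma assoc_r_le0 (s : 'I_M) a : assoc_r p rew s a <= 0.
Proof.
rewrite pmulr_rle0 ?mean_step_gt0// subr_le0.
exact: (fmax_ge (fun a => rew a / mean_step M p a)).
Qed.

Lemma assoc_r_eq0 (s : 'I_M) a : (assoc_r p rew s a == 0) = (a \in best).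
Proof. by rewrite mulf_eq0 gt_eqF ?mean_step_gt0//= subr_eq0 inE. Qed.

Lemma best_actions_neq0 : exists a, a \in best.
Proof.
have /card_gt0P[a _] := A_gt0.
have [b Eb] := fmax_attained (fun a => rew a / mean_step M p a) a.
by exists b; rewrite inE /best_ratio Eb.
Qed.

(** This reads the map sending [u] to [R(d) + Q(d) u] as a Gauss-Seidel sweep: rows are updated in
    increasing order, and row [l] uses the new values at [j < l] and the old ones elsewhere. *)
Lemma dec_affineE (d : decision A M) (u : 'I_M -> R) (l : 'I_M) :
  dec_reward p rew d l 0 + \sum_j dec_trans p d l j * u j =
  assoc_r p rew l (d l) + \sum_j assoc_P M p (d l) l j *
    (if (j < l)%N then
       dec_reward p rew d j 0 + \sum_k dec_trans p d j k * u k
     else u j).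
Proof.
rewrite dec_rewardE -addrA; congr (_ + _).
under [X in _ + X = _]eq_bigr do rewrite dec_transE mulrDl mulr_suml.
rewrite big_split exchange_big/= addrA -big_split/=.
rewrite [RHS](bigID (fun j : 'I_M => (j < l)%N))/=; congr (_ + _).
  apply: eq_bigr => i ->; rewrite mulrDr; congr (_ + _).
  by rewrite mulr_sumr; apply: eq_bigr => j _; rewrite mulrA.
rewrite [RHS]big_mkcond/=; apply: eq_bigr => j _; rewrite -leqNgt ltnNge.
by case: leqP => _; rewrite /= ?mul1r ?mul0r.
Qed.

(** Comparison principle for the sweep: the coefficients are nonnegative, so domination by [w]
    passes from the earlier rows to row [l]. *)
Lemma dec_affine_le (d : decision A M) (u w : 'I_M -> R) :
  (forall l : 'I_M, assoc_r p rew l (d l) + \sum_j assoc_P M p (d l) l j *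
     (if (j < l)%N then w j else u j) <= w l) ->
  forall l, dec_reward p rew d l 0 + \sum_j dec_trans p d l j * u j <= w l.
Proof.
move=> uw l; have [n] := ubnP (val l); elim: n l => // n IH l ln.
rewrite dec_affineE (le_trans _ (uw l))// lerD2l; apply: ler_sum => j _.
rewrite ler_wpM2l ?assoc_P_ge0//; case: ifP => // jl.
by apply: IH; rewrite (leq_trans jl).
Qed.

Lemma dec_affine_eq (d : decision A M) (u w : 'I_M -> R) :
  (forall l : 'I_M, assoc_r p rew l (d l) + \sum_j assoc_P M p (d l) l j *
     (if (j < l)%N then w j else u j) = w l) ->
  forall l, dec_reward p rew d l 0 + \sum_j dec_trans p d l j * u j = w l.
Proof.
move=> uw l; have [n] := ubnP (val l); elim: n l => // n IH l ln.
rewrite dec_affineE -(uw l); congr (_ + _); apply: eq_bigr => j _.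
congr (_ * _); case: ifP => // jl.
by apply: IH; rewrite (leq_trans jl).
Qed.

Lemma dec_trans_stochastic (d : decision A M) : stochastic (dec_trans p d).
Proof.
split=> [l j|l]; have [n] := ubnP (val l); elim: n l => // n IH l ln.
  rewrite dec_transE addr_ge0 ?mulr_ge0 ?ler0n ?assoc_P_ge0// sumr_ge0// => i il.
  by rewrite mulr_ge0 ?assoc_P_ge0// IH// (leq_trans il).
rewrite -(assoc_P_sum1 (d l) l).
under eq_bigr do rewrite dec_transE.
rewrite big_split exchange_big/= [RHS](bigID (fun j : 'I_M => (j < l)%N))/=.
congr (_ + _).
  by apply: eq_bigr => i il; rewrite -mulr_sumr IH ?mulr1// (leq_trans il).
rewrite [RHS]big_mkcond/=; apply: eq_bigr => j _; rewrite -leqNgt.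
by case: leqP => _; rewrite /= ?mul1r ?mul0r.
Qed.

Lemma dec_reward_le0 (d : decision A M) l : dec_reward p rew d l 0 <= 0.
Proof.
have := @dec_affine_le d (fun=> 0) (fun=> 0) _ l.
rewrite big1 ?addr0 => [|j _]; last by rewrite mulr0.
apply=> i; rewrite big1 ?addr0 ?assoc_r_le0// => j _.
by case: ifP; rewrite mulr0.
Qed.

Lemma dec_reward_eq0 (d : decision A M) :
  (forall l, d l \in best) <-> (forall l, dec_reward p rew d l 0 = 0).
Proof.
split=> [db l|d0 l].
  have := @dec_affine_eq d (fun=> 0) (fun=> 0) _ l.
  rewrite big1 ?addr0 => [|j _]; last by rewrite mulr0.
  apply=> i; rewrite big1 ?addr0 => [|j _]; last by case: ifP; rewrite mulr0.
  by apply/eqP; rewrite assoc_r_eq0.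
rewrite -(assoc_r_eq0 l); have := dec_rewardE p rew d l.
rewrite big1 ?addr0 => [<-|j _]; first by rewrite d0.
by rewrite d0 mulr0.
Qed.

(** No decision has a positive gain, because rewards are nonpositive and Cesaro limits nonnegative;
    a zero gain is therefore maximal. *)
Lemma average_optimal_gain0 (d : decision A M) :
  (forall s, (cesaro_lim (dec_trans p d) *m dec_reward p rew d) s 0 = 0) ->
  average_optimal p rew d.
Proof.
move=> d0 d' s; rewrite d0 mxE sumr_le0// => j _.
by rewrite mulr_ge0_le0 ?dec_reward_le0// cesaro_lim_ge0//;
  exact: dec_trans_stochastic.
Qed.

Lemma average_optimal_best (d : decision A M) :
  (forall l, d l \in best) -> average_optimal p rew d.
Proof.
move=> /dec_reward_eq0 d0; apply: average_optimal_gain0 => s.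
by rewrite mxE big1// => j _; rewrite d0 mulr0.
Qed.

Lemma approx_fixpoint_best (d : decision A M) (B : R) :
  (forall d : decision A M, average_optimal p rew d ->
     forall s, ~ transient (dec_trans p d) s) ->
  (forall e, 0 < e -> exists u : 'I_M -> R, (forall s, `|u s| <= B) /\
     (forall s, u s - e <=
        dec_reward p rew d s 0 + \sum_j dec_trans p d s j * u j)) ->
  forall l, d l \in best.
Proof.
move=> rec fixd; have sQ := dec_trans_stochastic d.
have [v [v0 vQ]] : exists v : 'I_M -> R, (forall s, 0 < v s) /\
    (forall j, \sum_s v s * dec_trans p d s j = v j).
  apply: recurrent_positive_invariant => //; apply: rec.
  apply: average_optimal_gain0 => s.
  apply: (@cesaro_lim_mul0 _ _ _ _ (2 * B)) => //; first exact: dec_reward_le0.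
  by move=> K; apply: approx_fixpoint_sum_ge.
have vR : 0 <= \sum_s v s * dec_reward p rew d s 0.
  apply/ler_addgt0Pl => e e0.
  (* Integrating the approximate inequality against [v] cancels the terms in [u]. The added 1 makes
     the divisor positive and keeps the integrated error below [e]. *)
  have V0 : 0 < 1 + \sum_s v s by rewrite ltr_pwDl// sumr_ge0// => s _; exact/ltW.
  have [|u [_ uQ]] := fixd (e / (1 + \sum_s v s)); first by rewrite divr_gt0.
  set e' := e / _ in uQ.
  have : 0 <= \sum_s v s * (dec_reward p rew d s 0 +
      \sum_j dec_trans p d s j * u j - (u s - e')).
    by rewrite sumr_ge0// => s _; rewrite mulr_ge0 ?subr_ge0// ltW.
  have -> : \sum_s v s * (dec_reward p rew d s 0 +
      \sum_j dec_trans p d s j * u j - (u s - e')) =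
      \sum_s v s * dec_reward p rew d s 0 + (\sum_s v s) * e'.
    have E : \sum_s v s * (\sum_j dec_trans p d s j * u j) = \sum_s v s * u s.
      under eq_bigr do rewrite mulr_sumr.
      rewrite exchange_big/=; apply: eq_bigr => j _.
      by rewrite -[in RHS]vQ mulr_suml; apply: eq_bigr => s _; rewrite mulrA.
    transitivity (\sum_s v s * dec_reward p rew d s 0 + (\sum_s v s) * e' +
      (\sum_s v s * (\sum_j dec_trans p d s j * u j) - \sum_s v s * u s)).
      rewrite mulr_suml -sumrB -!big_split/=.
      by apply: eq_bigr => s _; ring.
    by rewrite E subrr addr0.
  have : (\sum_s v s) * e' <= e.
    rewrite /e' mulrCA -[leRHS]mulr1 ler_pM2l// ler_pdivrMr// mul1r.
    by rewrite lerDr.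
  lra.
apply/dec_reward_eq0 => l.
have le0 s : v s * dec_reward p rew d s 0 <= 0.
  by rewrite mulr_ge0_le0 ?dec_reward_le0// ltW.
have : \sum_s - (v s * dec_reward p rew d s 0) = 0.
  apply/eqP; rewrite eq_le sumr_ge0 ?andbT => [|s _]; last by rewrite oppr_ge0.
  by rewrite sumrN oppr_le0.
move/psumr_eq0P => /(_ _ l isT) /eqP; rewrite oppr_eq0 mulf_eq0 gt_eqF//=.
by move=> h; apply/eqP/h => s _; rewrite oppr_ge0.
Qed.

(** * Blocks of the value function *)

Variable V : int -> R.
Hypothesis hV : max_total_reward M p rew V.

Let c := best_ratio M p rew.

(* Row [n] of [block_dev] is [V i - c i] for [i] in the [n]-th block of length
   [M], counted from [i = - M]. *)
Definition block_dev (n : nat) (s : 'I_M) : R :=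
  V ((n * M + s)%N%:Z - M%:Z) - best_ratio M p rew * ((n * M + s)%N%:R - M%:R).

(** Block 0 consists of the absorbing states, so block [n.+1] starts at the state [n * M] and obeys
    the Bellman equation. *)
Lemma block_devS n (s : 'I_M) :
  block_dev n.+1 s = V (n * M + s)%N%:Z - c * (n * M + s)%N%:R.
Proof.
rewrite /block_dev mulSn; congr (V _ - _ * _); first by lia.
by rewrite !natrD; ring.
Qed.

(** Removing the linear part [c i] replaces the reward by [rew a - c * mean_step M p a], which is
    [assoc_r]. A step from residue [l] to residue [j] stays in the block when [j < l] and otherwise
    enters the preceding one. *)
Lemma bellman_block n (l : 'I_M) a :
  bellman_rhs M p rew V (n * M + l)%N%:Z a - c * (n * M + l)%N%:R =
  assoc_r p rew l a + \sum_j assoc_P M p a l j *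
    (if (j < l)%N then block_dev n.+1 j else block_dev n j).
Proof.
have -> : bellman_rhs M p rew V (n * M + l)%N%:Z a - c * (n * M + l)%N%:R =
    rew a + \sum_(j < M) p (step_of M l j) a *
      (V ((n * M + l)%N%:Z - (step_of M l j)%:Z) - c * (n * M + l)%N%:R).
  rewrite /bellman_rhs (sum_step_of _ l) -addrA; congr (_ + _).
  rewrite -[X in _ - X]mulr1 -(p_sum1 a) (sum_step_of _ l) mulr_sumr -sumrB.
  by apply: eq_bigr => j _; ring.
rewrite assoc_rE /mean_step (sum_step_of _ l) -/c mulr_sumr -addrA; congr (_ + _).
rewrite addrC -sumrB; apply: eq_bigr => j _; rewrite mxE.
have -> : (if (j < l)%N then block_dev n.+1 j else block_dev n j) =
    V ((n * M + l)%N%:Z - (step_of M l j)%:Z) -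
    c * ((n * M + l)%N%:R - (step_of M l j)%:R).
  have jM := ltn_ord j; have lM := ltn_ord l.
  case: ifP => jl; rewrite ?block_devS /block_dev /step_of jl.
    congr (V _ - _ * _); first by lia.
    by rewrite natrB ?(ltnW jl)// !natrD; ring.
  congr (V _ - _ * _); first by lia.
  by rewrite natrB ?natrD; [ring|lia].
ring.
Qed.

(** The states involved are those of row [n.+1] of [block_dev], so such a [d] computes row [n.+1]
    from row [n]. *)
Definition greedy (n : nat) (d : decision A M) : Prop :=
  forall l : 'I_M, V (n * M + l)%N%:Z = bellman_rhs M p rew V (n * M + l)%N%:Z (d l).

Lemma greedy_block_dev n d : greedy n d -> forall l,
  dec_reward p rew d l 0 + \sum_j dec_trans p d l j * block_dev n j =
  block_dev n.+1 l.
Proof.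
by move=> gd; apply: dec_affine_eq => l; rewrite -bellman_block -gd block_devS.
Qed.

Lemma block_dev_ge n d l :
  dec_reward p rew d l 0 + \sum_j dec_trans p d l j * block_dev n j <=
  block_dev n.+1 l.
Proof.
apply: dec_affine_le => {}l; rewrite -bellman_block block_devS lerD2r hV.2//.
exact: fmax_ge.
Qed.

(** Maximizers can be chosen independently at the states of a block, so any single maximizing action
    extends to a greedy decision. *)
Lemma greedy_exists n (l : 'I_M) a :
  V (n * M + l)%N%:Z = bellman_rhs M p rew V (n * M + l)%N%:Z a ->
  exists2 d, greedy n d & d l = a.
Proof.
move=> Va.
have /choice[f fP] (i : 'I_M) : exists b,
    V (n * M + i)%N%:Z = bellman_rhs M p rew V (n * M + i)%N%:Z b.
  have [b Vb] := fmax_attained (bellman_rhs M p rew V (n * M + i)%N%:Z) a.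
  by exists b; rewrite -Vb hV.2.
exists [ffun i => if i == l then a else f i]; last by rewrite ffunE eqxx.
by move=> i; rewrite ffunE; case: eqP => [->|_].
Qed.

(** The bound of block 0 propagates, since stochastic matrices preserve it: from below through a
    constant decision in [best], whose reward is 0, and from above through a greedy decision, whose
    reward is nonpositive. *)
Lemma block_dev_bounded : exists B, forall n s, `|block_dev n s| <= B.
Proof.
exists (\sum_s `|block_dev 0 s|); elim=> [|n IH] l.
  by rewrite (bigD1 l)//= lerDl sumr_ge0.
set B := \sum_s _ in IH *.
have QB d : `|\sum_j dec_trans p d l j * block_dev n j| <= B.
  have [Q0 Q1] := dec_trans_stochastic d.
  rewrite (le_trans (ler_norm_sum _ _ _))// -[B]mul1r -(Q1 l) mulr_suml.
  by apply: ler_sum => j _; rewrite normrM (ger0_norm (Q0 _ _)) ler_wpM2l.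
have [a ab] := best_actions_neq0.
have [b Vb] := fmax_attained (bellman_rhs M p rew V (n * M + l)%N%:Z) a.
move: Vb; rewrite -hV.2// => /greedy_exists[d gd _].
rewrite ler_norml; apply/andP; split.
  have := block_dev_ge n [ffun=> a] l.
  rewrite ((dec_reward_eq0 _).1 _ l) ?add0r => [|i]; last by rewrite ffunE.
  by apply: le_trans; have := QB [ffun=> a]; rewrite ler_norml => /andP[].
rewrite -(greedy_block_dev gd); have := QB d; rewrite ler_norml => /andP[_].
have := dec_reward_le0 d l; lra.
Qed.

(** * Consequences of the recurrence and mixing conditions *)

Hypothesis rec : forall d : decision A M, average_optimal p rew d ->
  forall s, ~ transient (dec_trans p d) s.
Hypothesis mix : (exists J, (1 <= J)%N /\ gamma M p J < 1) \/
  (forall d : decision A M, average_optimal p rew d -> aperiodic (dec_trans p d)).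

Lemma block_dev_increment0 s :
  (fun n => block_dev n.+1 s - block_dev n s) @ \oo --> (0 : R).
Proof.
have [a ab] := best_actions_neq0; pose d : decision A M := [ffun=> a].
have db l : d l \in best by rewrite ffunE.
have sQ := dec_trans_stochastic d; have avgd := average_optimal_best db.
have [v [v0 vQ]] := recurrent_positive_invariant sQ (rec avgd).
have [B wB] := block_dev_bounded.
have w_sub n l : \sum_j dec_trans p d l j * block_dev n j <= block_dev n.+1 l.
  by have := block_dev_ge n d l; rewrite ((dec_reward_eq0 d).1 db) add0r.
case: mix => [[J [_ gJ]]|ap]; last first.
  by apply: (aperiodic_increment0 sQ v0 vQ wB w_sub); exact: ap.
apply: (scrambling_increment0 sQ v0 vQ wB w_sub (k := J)) => {}s u.
(* Evaluated at two copies of the constant sequence, [gamma M p J < 1] gives a positive overlap of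
   any two rows of the [J]-th power, that is, a common [J]-step successor. *)
pose ds := [tuple of nseq J d].
have Qds : trans_prod p ds = dec_trans p d ^+ J.
  by rewrite /trans_prod big_nseq; elim: (J) => //= n ->; rewrite exprS.
have : 0 < \sum_l Num.min ((dec_trans p d ^+ J) s l) ((dec_trans p d ^+ J) u l).
  rewrite -Qds; apply: lt_le_trans (fmin_le (fun su : 'I_M * 'I_M => \sum_(l < M)
    Num.min (trans_prod p ds su.1 l) (trans_prod p ds su.2 l)) (s, u)).
  apply: lt_le_trans (fmin_le (fun dd : J.-tuple (decision A M) *
    J.-tuple (decision A M) => overlap p dd.1 dd.2) (ds, ds)).
  by move: gJ; rewrite /gamma ltrBlDr ltrDl.
rewrite lt0r => /andP[/eqP + _] => /psumr_neq0P[l _|l].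
  by rewrite le_min !(stochasticX J sQ).1.
by rewrite lt_min => /= /andP[]; exists l.
Qed.

(** At a late greedy index [n] the affine map of [d] sends [block_dev n] to [block_dev n.+1], which
    is within [e] of it; thus [block_dev n] is an approximate fixed point. *)
Lemma greedy_infinitely_often (d : decision A M) :
  (forall N, exists2 n, (N <= n)%N & greedy n d) -> forall l, d l \in best.
Proof.
move=> io; have [B wB] := block_dev_bounded.
apply: (approx_fixpoint_best (B := B) rec) => e e0.
have /choice[N NP] s : exists N, forall n, (N <= n)%N ->
    `|block_dev n.+1 s - block_dev n s| < e.
  have /cvgr0Pnorm_lt/(_ e e0) [N _ NP] := @block_dev_increment0 s.
  by exists N.
have [n Nn gd] := io (\max_s N s)%N.
exists (block_dev n); split=> // s; rewrite greedy_block_dev//.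
have := NP s n (leq_trans (leq_bigmax s) Nn); rewrite ltr_norml => /andP[]; lra.
Qed.

Lemma eventually_best_actions : exists I : nat, forall i : int, I%:Z <= i ->
  forall a, V i = bellman_rhs M p rew V i a -> a \in best.
Proof.
(* A decision is either greedy infinitely often, hence valued in [best], or never greedy from some
   index on. *)
have /choice[N NP] (d : decision A M) : exists N, forall n, (N <= n)%N ->
    greedy n d -> forall l, d l \in best.
  have [io|nio] := pselect (forall N, exists2 n, (N <= n)%N & greedy n d).
    by exists 0 => n _ _; exact: greedy_infinitely_often.
  have /existsNP[N nN] := nio.
  by exists N => n Nn gd; case: nN; exists n.
(* The state [i] lies in the block with greedy index [i %/ M], so the largest threshold over the
   finitely many decisions is scaled by [M]. *)
exists ((\max_d N d) * M)%N => -[i Ii|//] a.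
pose l : 'I_M := Ordinal (ltn_pmod i M_gt0).
rewrite (divn_eq i M) -[(i %% M)%N]/(val l) => /greedy_exists[d gd <-].
apply: NP gd l; apply: leq_trans (leq_bigmax d) _.
by rewrite leq_divRL// -lez_nat.
Qed.

End Model.

Theorem theorem3 (R : realType) (A : finType) (hA : (0 < #|A|)%N)
  (M : nat) (hM : (1 <= M)%N)
  (p : nat -> A -> R) (rew : A -> R)
  (p_ge0 : forall (a : A) (m : nat), (1 <= m <= M)%N -> 0 <= p m a)
  (p_sum1 : forall a : A, \sum_(1 <= m < M.+1) p m a = 1)
  (V : int -> R) (hV : max_total_reward M p rew V)
  (h1 : forall dstar : decision A M, average_optimal p rew dstar ->
          forall s : 'I_M, ~ transient (dec_trans p dstar) s)
  (h2 : (exists J : nat, (1 <= J)%N /\ gamma M p J < 1) \/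
        (forall dstar : decision A M, average_optimal p rew dstar ->
           aperiodic (dec_trans p dstar))) :
  exists I : nat, forall i : int, I%:Z <= i ->
    forall a : A, V i = bellman_rhs M p rew V i a ->
      a \in best_actions M p rew.
Proof. exact: eventually_best_actions. Qed.
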